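(* Let $a,b$ be complex numbers (or indeterminates) and define $g(n,a,b)$ by $$G(z,a,b)=\sum_{n\ge0}g(n,a,b)z^n=\frac{1}{\sqrt{(1-az)^2-4bz^2}}.$$ Then for every integer $n>0$, $$\det\big(g(i+j,a,b)\big)_{i,j=0}^{n-1}=2^{n-1}b^{\binom n2},\qquad \det\big(g(i+j+1,a,b)\big)_{i,j=0}^{n-1}=2^{n-1}b^{\binom n2}\,\mathrm{Luc}_n(a,-b),$$ $$\det\big(g(i+j+2,a,b)\big)_{i,j=0}^{n-1}=2^{n-1}b^{\binom n2}\Big(2b^n+\sum_{j=1}^n \mathrm{Luc}_j(a,-b)^2\,b^{n-j}\Big).$$
   Context: The normalized Lucas polynomials $\mathrm{Luc}_n(x,s)$ are defined by $\mathrm{Luc}_0=1$, $\mathrm{Luc}_1=x$, $\mathrm{Luc}_2=x^2+2s$, and $\mathrm{Luc}_n=x\,\mathrm{Luc}_{n-1}+s\,\mathrm{Luc}_{n-2}$ for $n>2$; for $n\ge1$ they coincide with the Lucas polynomials $L_n(x,s)$ (with $L_0=2$, $L_1=x$, $L_n=xL_{n-1}+sL_{n-2}$). The last expression equals $2^{n-1}b^{\binom{n+1}2}\big(2+\sum_{j=1}^n\mathrm{Luc}_j(a,-b)^2/b^j\big)$. The generating function is the formal power series with constant term $1$. *)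

(* Defs.v *)
From mathcomp Require Import all_boot all_order all_algebra.

Set Implicit Arguments.
Unset Strict Implicit.
Unset Printing Implicit Defensive.

Import GRing.Theory Num.Theory.
Local Open Scope ring_scope.

(* A formal power series is represented by its coefficient sequence. *)
Section FormalPowerSeries.
Variable R : comUnitRingType.
Implicit Types (f g s p : nat -> R) (a b x : R).

Definition fps_of_poly (p : {poly R}) : nat -> R := fun n => p`_n.

Definition fps_mul f g : nat -> R :=
  fun n => \sum_(i < n.+1) f i * g (n - i)%N.

(* Equality of series is stated coefficientwise (=1), so that no
   extensionality axiom is involved. *)
Definition fps_is_sqrt p s : Prop := s 0%N = 1 /\ fps_mul s s =1 p.

Definition fps_is_inv s g : Prop := fps_mul s g =1 fps_of_poly 1.

Definition fps_is_inv_sqrt p g : Prop :=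
  exists2 s, fps_is_sqrt p s & fps_is_inv s g.

Definition Gradicand a b : {poly R} :=
  (1 - a *: 'X) ^+ 2 - (4 * b) *: 'X^2.

Definition is_gseq a b g : Prop :=
  fps_is_inv_sqrt (fps_of_poly (Gradicand a b)) g.

Fixpoint Luc (x s : R) (n : nat) : R :=
  match n with
  | 0 => 1
  | 1 => x
  | 2 => x ^+ 2 + 2 * s
  | (m.+1 as k).+1 => x * Luc x s k + s * Luc x s m
  end.

(* [is_gseq a b] determines exactly one sequence as soon as 2 is invertible. *)

Lemma fps_recursor (F : (nat -> R) -> nat -> R) :
  (forall n u v, (forall i, (i < n)%N -> u i = v i) -> F u n = F v n) ->
  exists u, forall n, u n = F u n.
Proof.
move=> Floc.
pose A := fix A n : seq R :=
  if n is m.+1 then rcons (A m) (F (nth 0 (A m)) m) else [::].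
have sA n : size (A n) = n by elim: n => //= n IH; rewrite size_rcons IH.
have stab m i : (i < m)%N -> nth 0 (A m) i = nth 0 (A i.+1) i.
  elim: m => // m IH; rewrite ltnS leq_eqVlt => /predU1P[-> //|lim].
  by rewrite [LHS]/= nth_rcons sA lim IH.
exists (fun n => nth 0 (A n.+1) n) => n /=.
rewrite nth_rcons sA ltnn eqxx; apply: Floc => i ltin.
by rewrite stab //= .
Qed.

Lemma fps_mulS f g n :
  fps_mul f g n.+1 =
  f 0%N * g n.+1 + f n.+1 * g 0%N + \sum_(i < n) f i.+1 * g (n - i)%N.
Proof.
rewrite /fps_mul big_ord_recl big_ord_recr /= subn0 /bump /= !add1n subnn.
rewrite -addrA [f n.+1 * _ + _]addrC; congr (_ + (_ + _)).
Qed.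

Lemma fps_mul0 f g : fps_mul f g 0 = f 0%N * g 0%N.
Proof. by rewrite /fps_mul big_ord1. Qed.

Lemma fps_sqrt_exists p : (2 : R) \is a GRing.unit -> p 0%N = 1 ->
  exists s, fps_is_sqrt p s.
Proof.
move=> u2 p0.
have [|s sE] := @fps_recursor (fun u n =>
    if n is m.+1 then (p n - \sum_(i < m) u i.+1 * u (m - i)%N) / 2 else 1).
  case=> // n u v uv; congr ((_ - _) / _); apply: eq_bigr => i _.
  by rewrite !uv ?ltnS ?leq_subr.
exists s; split; first by rewrite sE.
case=> [|n]; first by rewrite fps_mul0 sE p0 mulr1.
rewrite fps_mulS [s 0%N]sE mul1r mulr1 -mulr2n -mulr_natr [s n.+1]sE.
by rewrite divrK // subrK.
Qed.

Lemma fps_inv_exists s : s 0%N = 1 -> exists g, fps_is_inv s g.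
Proof.
move=> s0.
have [|g gE] := @fps_recursor (fun u n =>
    if n is m.+1 then - (s n * u 0%N + \sum_(i < m) s i.+1 * u (m - i)%N)
    else 1).
  case=> // n u v uv; congr (- (_ * _ + _)); first by rewrite uv.
  by apply: eq_bigr => i _; rewrite uv ?ltnS ?leq_subr.
exists g; case=> [|n]; rewrite /fps_of_poly coef1.
  by rewrite fps_mul0 s0 gE mulr1.
by rewrite fps_mulS s0 mul1r -addrA [g n.+1]gE addNr.
Qed.

Lemma Gradicand0 a b : fps_of_poly (Gradicand a b) 0%N = 1.
Proof.
rewrite /fps_of_poly /Gradicand -horner_coef0 !hornerE /=.
by rewrite ?(mulr0, expr0n, subr0, expr1n).
Qed.

Lemma gseq_exists a b : (2 : R) \is a GRing.unit -> exists g, is_gseq a b g.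
Proof.
move=> u2; have [s sP] := fps_sqrt_exists u2 (Gradicand0 a b).
by have [g gP] := fps_inv_exists sP.1; exists g, s.
Qed.

Lemma fps_sqrt_unique p s s' : (2 : R) \is a GRing.unit ->
  fps_is_sqrt p s -> fps_is_sqrt p s' -> s =1 s'.
Proof.
move=> u2 [s0 sp] [s0' sp']; elim/ltn_ind=> -[|n] IH; first by rewrite s0.
have := sp n.+1; rewrite -sp' !fps_mulS s0 s0' !mul1r !mulr1 -!mulr2n.
have -> : \sum_(i < n) s i.+1 * s (n - i)%N =
          \sum_(i < n) s' i.+1 * s' (n - i)%N.
  by apply: eq_bigr => i _; rewrite !IH ?ltnS ?leq_subr.
by move/addIr; rewrite -[LHS]mulr_natr -[RHS]mulr_natr => /(mulIr u2).
Qed.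

Lemma fps_inv_unique s s' g g' : s 0%N = 1 -> s =1 s' ->
  fps_is_inv s g -> fps_is_inv s' g' -> g =1 g'.
Proof.
move=> s0 ss gP gP'; have s0' : s' 0%N = 1 by rewrite -ss.
elim/ltn_ind=> -[|n] IH.
  by have := gP 0%N; rewrite -gP' !fps_mul0 s0 s0' !mul1r.
have := gP n.+1; rewrite -gP' !fps_mulS s0 s0' !mul1r ss (IH 0%N) //.
have -> : \sum_(i < n) s i.+1 * g (n - i)%N =
          \sum_(i < n) s' i.+1 * g' (n - i)%N.
  by apply: eq_bigr => i _; rewrite ss IH ?ltnS ?leq_subr.
by move/addIr/addIr.
Qed.

Lemma gseq_unique a b g g' : (2 : R) \is a GRing.unit ->
  is_gseq a b g -> is_gseq a b g' -> g =1 g'.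
Proof.
move=> u2 [s sP gP] [s' sP' gP'].
exact: fps_inv_unique sP.1 (fps_sqrt_unique u2 sP sP') gP gP'.
Qed.

End FormalPowerSeries.

(* Invertibility of 2 for complex numbers and for two indeterminates over
   them. *)

Lemma unit2_num (C : numFieldType) : (2 : C) \is a GRing.unit.
Proof. by rewrite unitfE pnatr_eq0. Qed.

Lemma unit2_poly2 (C : numFieldType) :
  (2 : {poly {poly C}}) \is a GRing.unit.
Proof.
have -> : (2 : {poly {poly C}}) = ((2 : C)%:P)%:P by rewrite !rmorph_nat.
by do 2!apply: rmorph_unit; exact: unit2_num.
Qed.

(* Main.v *)
Require Import Defs.
From mathcomp Require Import all_boot all_order all_algebra.
From mathcomp Require Import ring zify.

(** Let [F] be the power series with [F = z (1 + a F + b F^2)].  Then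
    [(1 - a z - 2 b z F)^2 = (1 - a z)^2 - 4 b z^2], so the generating function
    [G] of [g] is the inverse of [1 - a z - 2 b z F], and the coefficients
    [c n k] of [z^n] in [G F^k] satisfy a three-term recurrence: the shift
    [n -> n + 1] is right multiplication by a tridiagonal matrix [J].  With
    [d = (1, 2 b, 2 b^2, ...)] one gets [g (i + j) = sum_k c i k * d k * c j k],
    hence, [C] being lower unitriangular, the three Hankel matrices are
    [C D C^T], [C D J^T C^T] and [C U C^T] where [U] is the [n * n] truncation
    of the infinite product [J D J^T].  Now [det J_n = Luc_n (a, -b)] by the
    continuant recurrence, and [U_n] differs from [J_n D_n J_n^T] only by [d n]
    in its last diagonal entry, so that
    [det U_n = Luc_n ^ 2 * det D_n + d n * det U_(n-1)]. *)

Set Implicit Arguments.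
Unset Strict Implicit.
Unset Printing Implicit Defensive.

Import GRing.Theory.
Local Open Scope ring_scope.

(** * Determinants of matrices given by functions of natural indices *)

Section Determinants.
Variable R : comNzRingType.
Implicit Types (f h : nat -> nat -> R) (u : nat -> R) (x : R).

Definition natmx m n f : 'M[R]_(m, n) := \matrix_(i, j) f i j.

(** The hypothesis covers an index [k] beyond the truncation, where both sides are 0. *)
Lemma sum_delta n u x k : ((n <= k)%N -> u k = 0) ->
  \sum_(l < n) u l * (x *+ (l == k :> nat)) = u k * x.
Proof.
move=> u0; case: (ltnP k n) => [ltkn|lenk].
  rewrite (bigD1 (Ordinal ltkn)) //= eqxx big1 ?addr0 // => i.
  by rewrite -val_eqE /= => /negPf->; rewrite mulr0.
rewrite u0 // mul0r big1 // => i _.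
by rewrite [_ == k :> nat]ltn_eqF ?mulr0 // (leq_trans _ lenk).
Qed.

Lemma eq_natmx m n f h :
  (forall i j, (i < m)%N -> (j < n)%N -> f i j = h i j) ->
  natmx m n f = natmx m n h.
Proof. by move=> fh; apply/matrixP => i j; rewrite !mxE fh. Qed.

Lemma natmx_mul m n p f h :
  natmx m n f *m natmx n p h = natmx m p (fun i j => \sum_(k < n) f i k * h k j).
Proof.
by apply/matrixP => i j; rewrite !mxE; apply: eq_bigr => k _; rewrite !mxE.
Qed.

Lemma tr_natmx m n f : (natmx m n f)^T = natmx n m (fun i j => f j i).
Proof. by apply/matrixP => i j; rewrite !mxE. Qed.

Lemma det_natmx_lower1 n f : (forall i j, (i < j)%N -> f i j = 0) ->
  (forall i, f i i = 1) -> \det (natmx n n f) = 1.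
Proof.
move=> f0 f1; rewrite det_trig; first by apply: big1 => i _; rewrite mxE f1.
by apply/is_trig_mxP => i j ltij; rewrite mxE f0.
Qed.

Lemma det_natmx_diag n u :
  \det (natmx n n (fun i j => u j *+ (i == j))) = \prod_(i < n) u i.
Proof.
rewrite det_trig; first by apply: eq_bigr => i _; rewrite mxE eqxx.
by apply/is_trig_mxP => i j ltij; rewrite mxE ltn_eqF.
Qed.

Lemma det_natmx_gram n f u h :
  \det (natmx n n (fun i j => \sum_(k < n) f i k * u k * h j k)) =
    \det (natmx n n f) * \prod_(k < n) u k * \det (natmx n n h).
Proof.
rewrite -det_natmx_diag -(det_tr (natmx n n h)) tr_natmx -!det_mulmx !natmx_mul.
congr (\det _); apply: eq_natmx => i j _ _; apply: eq_bigr => k _.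
by rewrite sum_delta // leqNgt ltn_ord.
Qed.

Lemma cofactor_natmx_max n f :
  cofactor (natmx n.+1 n.+1 f) ord_max ord_max = \det (natmx n n f).
Proof.
rewrite /cofactor /= addnn -signr_odd odd_double mul1r; congr (\det _).
by apply/matrixP => i j; rewrite !mxE !lift_max.
Qed.

(** Both matrices have the same cofactors along the last row, and the corner cofactor is the leading
    minor of size [n]. *)
Lemma det_natmx_corner n f h x :
  (forall i j, (i <= n)%N -> (j <= n)%N ->
     h i j = f i j + x *+ ((i == n) && (j == n))) ->
  \det (natmx n.+1 n.+1 h) =
    \det (natmx n.+1 n.+1 f) + x * \det (natmx n n f).
Proof.
move=> hE; rewrite -(cofactor_natmx_max n f).
rewrite (expand_det_row _ ord_max) (expand_det_row (natmx _ _ f) ord_max).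
have cofE j : cofactor (natmx n.+1 n.+1 h) ord_max j =
              cofactor (natmx n.+1 n.+1 f) ord_max j.
  rewrite /cofactor; congr (_ * \det _); apply/matrixP => i k.
  rewrite !mxE hE ?leq_ord // lift_max.
  by rewrite [_ == n]ltn_eqF //= addr0.
rewrite !big_ord_recr /= !cofE !mxE hE // eqxx mulr1n mulrDl addrA.
congr (_ + _ + _); apply: eq_bigr => j _.
by rewrite cofE !mxE hE ?leq_ord //= (ltn_eqF (ltn_ord j)) andbF addr0.
Qed.

(** The last row has at most two nonzero entries; in the off-diagonal minor the last column keeps
    only [f n n.+1]. *)
Lemma det_tridiagonal n f :
  (forall i j, (i.+1 < j)%N || (j.+1 < i)%N -> f i j = 0) ->
  \det (natmx n.+2 n.+2 f) =
    f n.+1 n.+1 * \det (natmx n.+1 n.+1 f)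
      - f n.+1 n * f n n.+1 * \det (natmx n n f).
Proof.
move=> f0; rewrite (expand_det_row _ ord_max) big_ord_recr big_ord_recr /=.
rewrite big1 ?add0r => [|j _]; last by rewrite !mxE f0 ?mul0r //= !ltnS ltn_ord orbT.
rewrite cofactor_natmx_max !mxE /= addrC; congr (_ + _).
rewrite -mulrA -mulrN; congr (_ * _).
set j1 := widen_ord _ _.
rewrite /cofactor /= -signr_odd addSn addnn /= odd_double expr1 mulN1r.
congr (- _); rewrite (expand_det_col _ ord_max) big_ord_recr /= big1 ?add0r => [|i _].
  rewrite !mxE !lift_max /= /bump leqnn add1n; congr (_ * _).
  rewrite /cofactor /= addnn -signr_odd odd_double mul1r; congr (\det _).
  have bumpE m (k : 'I_n) : (n <= m)%N -> bump m k = k.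
    by move=> lenm; rewrite /bump leqNgt (leq_trans (ltn_ord k)).
  by apply/matrixP => i j; rewrite !mxE /= !bumpE.
rewrite !mxE !lift_max /= /bump leqnn add1n.
by rewrite f0 ?mul0r // !ltnS ltn_ord.
Qed.

End Determinants.

(** * The triangle [tri], its weights and its tridiagonal matrix *)

Section Triangle.
Variables (R : comUnitRingType) (a b : R).

(* [tri n k] is the coefficient of [t^k] in [(a + t + b / t)^n]; the factor 2 at
   [k = 0] folds in the coefficient of [t^-1], which is [b * tri n 1]. *)
Fixpoint tri (n k : nat) : R :=
  match n, k with
  | 0, 0 => 1
  | 0, _.+1 => 0
  | m.+1, 0 => a * tri m 0 + 2 * b * tri m 1
  | m.+1, l.+1 => a * tri m l.+1 + tri m l + b * tri m l.+2
  end.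

(** The sequence [d]; with these weights, [jac l k * wt k] is symmetric in [l] and [k]. *)
Definition wt (k : nat) : R := if k is 0 then 1 else 2 * b ^+ k.
Arguments wt : simpl never.

Definition jac (l k : nat) : R :=
  a *+ (l == k) + 1 *+ (l.+1 == k) + (if k is 0 then 2 * b else b) *+ (l == k.+1).

Lemma tri_gt n k : (n < k)%N -> tri n k = 0.
Proof.
elim: n k => [|n IH] [|k] //=; rewrite ltnS => ltnk.
by rewrite !IH ?mulr0 ?addr0 // ltnW // ltnW.
Qed.

Lemma tri_diag n : tri n n = 1.
Proof. by elim: n => //= n ->; rewrite !tri_gt // !mulr0 add0r addr0. Qed.

Lemma triS n i k : (i < n)%N -> tri i.+1 k = \sum_(l < n) tri i l * jac l k.
Proof.
move=> ltin; rewrite /jac.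
have tri0 l : (n <= l)%N -> tri i l = 0.
  by move=> lenl; rewrite tri_gt // (leq_trans ltin).
rewrite (eq_bigr (fun l : 'I_n => tri i l * (a *+ (l == k :> nat))
   + tri i l * (1 *+ (l.+1 == k))
   + tri i l * ((if k is 0 then 2 * b else b) *+ (l == k.+1 :> nat)))); last first.
  by move=> l _; rewrite !mulrDr.
rewrite !big_split /= !sum_delta //; try by move=> ?; apply: tri0.
case: k => [|k] /=.
  rewrite big1 => [|l _]; last by rewrite mulr0.
  by ring.
rewrite (eq_bigr (fun l : 'I_n => tri i l * (1 *+ (l == k :> nat)))) //.
rewrite sum_delta; last by move=> ?; apply: tri0.
ring.
Qed.

Lemma wtS k : wt k.+2 = b * wt k.+1.
Proof. by rewrite /wt [b ^+ k.+2]exprS; ring. Qed.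

(** Symmetry of [jac l k * wt k] moves a shift from [i] to [j]; as in summation by parts, cutting
    the sum leaves one boundary term. *)
Lemma tri_shift_telescope i j n :
  \sum_(k < n.+1) tri i.+1 k * wt k * tri j k =
  \sum_(k < n.+1) tri i k * wt k * tri j.+1 k
   + wt n.+1 * (tri i n.+1 * tri j n - tri i n * tri j n.+1).
Proof.
elim: n => [|n IH]; first by rewrite !big_ord1 /= /wt expr1; ring.
rewrite big_ord_recr /= IH [in RHS]big_ord_recr wtS.
move: (wt n.+1) => w /=; ring.
Qed.

Lemma sum_tri_trunc i j m e : (i < m)%N ->
  \sum_(k < m + e) tri i k * wt k * tri j k =
  \sum_(k < m) tri i k * wt k * tri j k.
Proof.
move=> ltim; elim: e => [|e IH]; first by rewrite addn0.
rewrite addnS big_ord_recr IH /= tri_gt ?mul0r ?addr0 //.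
by rewrite (leq_trans ltim) // leq_addr.
Qed.

Lemma tri_hankel i j m : (i < m)%N ->
  tri (i + j) 0 = \sum_(k < m) tri i k * wt k * tri j k.
Proof.
(* The range extends past [i] and [j], so boundary terms vanish; the slack [e] takes it past [m],
   and [sum_tri_trunc] then cuts it back to [m]. *)
suff trij e : tri (i + j) 0 = \sum_(k < (i + j + e).+1) tri i k * wt k * tri j k.
  move=> ltim; rewrite (trij m) -(sum_tri_trunc j (i + j).+1 ltim).
  by rewrite -addSn addnC.
elim: i j e => [|i IH] j e.
  rewrite add0n big_ord_recl big1 => [|k _]; first by rewrite /= /wt !mul1r addr0.
  by rewrite /= !mul0r.
rewrite tri_shift_telescope addSnnS (IH _ e).
by rewrite (@tri_gt i) ?(@tri_gt j (_.+1)) ?mul0r ?mulr0 ?subrr ?mulr0 ?addr0 //; lia.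
Qed.

Lemma det_tri n : \det (natmx n n tri) = 1.
Proof. by apply: det_natmx_lower1; [exact: tri_gt|exact: tri_diag]. Qed.

Lemma prod_wt n : \prod_(k < n.+1) wt k = 2 ^+ n * b ^+ 'C(n.+1, 2).
Proof.
elim: n => [|n IH]; first by rewrite big_ord1 /= /wt mul1r.
rewrite big_ord_recr IH /= /wt [in RHS]binS bin1 [2 ^+ n.+1]exprS exprD; ring.
Qed.

(** * Determinants of [jac] and of its weighted Gram matrices *)

Lemma jac_diag k : jac k k = a.
Proof.
by rewrite /jac eqxx [_.+1 == _]gtn_eqF // [_ == _.+1]ltn_eqF // !addr0.
Qed.

Lemma jac_super l k : (l <= k)%N -> jac l k.+1 = (l == k)%:R.
Proof.
move=> lelk; rewrite /jac eqSS.
rewrite (@ltn_eqF l k.+1) // (@ltn_eqF l k.+2) ?ltnS ?leqW //.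
by rewrite add0r addr0.
Qed.

Lemma jac_sub k : jac k.+1 k = if k is 0 then 2 * b else b.
Proof.
by rewrite /jac eqxx [_.+1 == _]gtn_eqF // [_.+2 == _]gtn_eqF // !add0r.
Qed.

Lemma det_jac n : \det (natmx n n jac) = Luc a (- b) n.
Proof.
suff [] : \det (natmx n n jac) = Luc a (- b) n /\
          \det (natmx n.+1 n.+1 jac) = Luc a (- b) n.+1 by [].
elim: n => [|n [IH1 IH2]].
  by rewrite det_mx00 det_mx11 mxE jac_diag.
split=> //; rewrite det_tridiagonal ?IH1 ?IH2.
  rewrite jac_diag jac_sub jac_super // eqxx.
  (* The exceptional entry [jac 1 0 = 2 * b] matches the exceptional value of [Luc] at 2. *)
  by case: n {IH1 IH2} => [|n] /=; ring.
move=> i j far; rewrite /jac.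
have [-> -> ->] : [/\ (i == j) = false, (i.+1 == j) = false & (i == j.+1) = false].
  by split; lia.
by rewrite !addr0.
Qed.

(* At size [n], [jacsq n] is [J D J^T] for the truncated [J], while [jacsq n.+1]
   is the truncation [U_n] of the infinite product, since [jac l k = 0] for
   [l.+1 < k]. *)
Definition jacsq m i j := \sum_(k < m) jac i k * wt k * jac j k.

Lemma det_jacsq n :
  \det (natmx n n (jacsq n)) = Luc a (- b) n ^+ 2 * \prod_(k < n) wt k.
Proof. by rewrite det_natmx_gram det_jac; ring. Qed.

(** Among rows up to [n], only row [n] of [jac] meets column [n.+1], so the additional summand
    changes the corner alone. *)
Lemma det_jacsqS n :
  \det (natmx n.+1 n.+1 (jacsq n.+2)) =
    \det (natmx n.+1 n.+1 (jacsq n.+1)) + wt n.+1 * \det (natmx n n (jacsq n.+1)).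
Proof.
apply: det_natmx_corner => i j lein lejn.
rewrite /jacsq big_ord_recr /= !jac_super //; congr (_ + _).
by case: (i == n); case: (j == n); rewrite /= ?mul1r ?mulr1 ?mul0r ?mulr0.
Qed.

Lemma det_jacsq_closed n :
  \det (natmx n.+1 n.+1 (jacsq n.+2)) =
  2 ^+ n * b ^+ 'C(n.+1, 2) * (2 * b ^+ n.+1
     + \sum_(1 <= j < n.+2) Luc a (- b) j ^+ 2 * b ^+ (n.+1 - j)).
Proof.
elim: n => [|n IH].
  by rewrite det_jacsqS det_jacsq det_mx00 prod_wt big_nat1 /= /wt; ring.
have binE : 'C(n.+2, 2) = ('C(n.+1, 2) + n.+1)%N by rewrite binS bin1.
pose L j := Luc a (- b) j.
have sumE : \sum_(1 <= j < n.+3) L j ^+ 2 * b ^+ (n.+2 - j) =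
    b * (\sum_(1 <= j < n.+2) L j ^+ 2 * b ^+ (n.+1 - j)) + L n.+2 ^+ 2.
  rewrite big_nat_recr // subnn mulr1 mulr_sumr; congr (_ + _).
  by apply: eq_big_nat => j /andP[_ ltjn]; rewrite mulrCA -exprS -subSn.
by rewrite det_jacsqS IH det_jacsq prod_wt sumE binE exprD /wt !exprS -/L; ring.
Qed.

(** * The three Hankel determinants of [tri] *)

Lemma det_tri_hankel n :
  \det (natmx n n (fun i j => tri (i + j) 0)) = \prod_(k < n) wt k.
Proof.
rewrite (@eq_natmx _ _ _ _ (fun i j => \sum_(k < n) tri i k * wt k * tri j k)).
  by rewrite det_natmx_gram det_tri !mulr1 mul1r.
by move=> i j ltin _; exact: tri_hankel.
Qed.

Lemma det_tri_hankel1 n :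
  \det (natmx n n (fun i j => tri (i + j + 1) 0)) =
    (\prod_(k < n) wt k) * Luc a (- b) n.
Proof.
pose h j k := \sum_(l < n) tri j l * jac l k.
rewrite (@eq_natmx _ _ _ _ (fun i j => \sum_(k < n) tri i k * wt k * h j k)).
  by rewrite det_natmx_gram -natmx_mul det_mulmx det_tri det_jac; ring.
move=> i j ltin ltjn; rewrite -addnA addn1 (tri_hankel _ ltin).
by apply: eq_bigr => k _; rewrite (triS _ ltjn).
Qed.

Lemma det_tri_hankel2 n :
  \det (natmx n n (fun i j => tri (i + j + 2) 0)) = \det (natmx n n (jacsq n.+1)).
Proof.
have -> : natmx n n (fun i j => tri (i + j + 2) 0)
        = natmx n n tri *m natmx n n (jacsq n.+1) *m (natmx n n tri)^T.
  rewrite tr_natmx !natmx_mul; apply: eq_natmx => i j ltin ltjn.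
  have -> : (i + j + 2 = i.+1 + j.+1)%N by lia.
  (* The shifted index [i.+1] can reach [n], hence [n.+1] summands and [jacsq n.+1] at size [n]. *)
  rewrite (@tri_hankel _ _ n.+1) //.
  under eq_bigr do rewrite (triS _ ltin) (triS _ ltjn) mulr_suml mulr_sumr.
  under eq_bigr do under eq_bigr do rewrite mulr_suml.
  rewrite exchange_big; apply: eq_bigr => m _.
  rewrite /jacsq mulr_suml exchange_big; apply: eq_bigr => l _.
  rewrite mulr_sumr mulr_suml; apply: eq_bigr => k _; ring.
by rewrite !det_mulmx det_tr det_tri mul1r mulr1.
Qed.

End Triangle.

(** * Identification of the coefficients of the generating function with [tri] *)

Section GeneratingFunction.
Variables (R : comUnitRingType) (a b : R).
Implicit Types (p q F : {poly R}) (s g : nat -> R).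

Lemma coef_eq0_Xn p N : (forall i, (i < N)%N -> p`_i = 0) ->
  exists r, p = r * 'X^N.
Proof.
move=> p0; exists (drop_poly N p); rewrite -[LHS](poly_take_drop N).
have -> : take_poly N p = 0.
  by apply/polyP => i; rewrite coef_take_poly coef0; case: ifP => // /p0.
by rewrite add0r.
Qed.

(** A unit constant term permits cancellation modulo ['X^N] even if [R] has zero divisors. *)
Lemma coef_mul_eq0 p q N : q`_0 \is a GRing.unit ->
  (forall i, (i < N)%N -> (p * q)`_i = 0) -> forall i, (i < N)%N -> p`_i = 0.
Proof.
move=> uq pq0; elim/ltn_ind => i IH ltiN; have := pq0 i ltiN.
rewrite coefM big_ord_recr /= big1 ?add0r ?subnn => [|j _].
  by move=> e; apply: (mulIr uq); rewrite e mul0r.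
by rewrite IH ?mul0r // (ltn_trans _ ltiN).
Qed.

(* Approximates [F] modulo ['X^N], by iterating its fixed-point equation. *)
Lemma motzkin_approx N :
  exists F r, F = 'X * (1 + a%:P * F + b%:P * F ^+ 2) + r * 'X^N.
Proof.
elim: N => [|N [F [r FE]]].
  by exists 0, (- 'X); rewrite expr0; ring.
pose F' := 'X * (1 + a%:P * F + b%:P * F ^+ 2).
(* The cofactor comes from factoring [F - F'] out of the difference of the two quadratics. *)
exists F', (r * (a%:P + b%:P * (F + F'))).
have dF : F - F' = r * 'X^N by rewrite {1}FE addrC addKr.
rewrite {1}/F' ['X^(N.+1)]exprS.
transitivity ('X * (1 + a%:P * F' + b%:P * F' ^+ 2)
  + 'X * (F - F') * (a%:P + b%:P * (F + F'))); first by ring.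
by rewrite dF; ring.
Qed.

Lemma coef_poly_mul s g N i : (i < N)%N ->
  (\poly_(i < N) s i * \poly_(i < N) g i)`_i = fps_mul s g i.
Proof.
move=> ltiN; rewrite coefM; apply: eq_bigr => j _.
by rewrite !coef_poly !(leq_ltn_trans _ ltiN) ?leq_subr // -ltnS.
Qed.

Lemma gseq_tri g n : (2 : R) \is a GRing.unit -> is_gseq a b g ->
  g n = tri a b n 0.
Proof.
move=> u2 [s [s0 sP] gP]; set N := n.+1.
have [F [r FE]] := motzkin_approx N.
pose S : {poly R} := 1 - a%:P * 'X - 2 * b%:P * 'X * F.
pose T := \poly_(i < N) s i; pose G := \poly_(i < N) g i.
have SE : S * S = Gradicand a b - 4 * b%:P * 'X * r * 'X^N.
  have -> : Gradicand a b = (1 - a%:P * 'X) ^+ 2 - 4 * b%:P * 'X^2.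
    by rewrite /Gradicand -!mul_polyC polyCM rmorph_nat.
  transitivity ((1 - a%:P * 'X) ^+ 2 - 4 * b%:P * 'X^2
    - 4 * b%:P * 'X * (F - 'X * (1 + a%:P * F + b%:P * F ^+ 2))).
    by rewrite /S; ring.
  by rewrite {1}FE; ring.
(* [S] and [T] have equal squares modulo ['X^N]; since [S + T] has unit constant term, they agree
   modulo ['X^N]. *)
have ST0 : (S + T)`_0 = 2.
  have -> : S = 1 - 'X * (a%:P + 2 * b%:P * F) by rewrite /S; ring.
  by rewrite coefD coef_poly /= s0 coefB coef1 coefXM subr0.
have [r1 E1] : exists r, S - T = r * 'X^N.
  apply: coef_eq0_Xn; apply: (@coef_mul_eq0 _ (S + T)); first by rewrite ST0.
  move=> i ltiN; have -> : (S - T) * (S + T) = S * S - T * T by ring.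
  by rewrite coefB SE coefB coefMXn ltiN coef_poly_mul // sP subr0 subrr.
have [r2 E2] : exists r, T * G - 1 = r * 'X^N.
  by apply: coef_eq0_Xn => i ltiN; rewrite coefB coef_poly_mul // gP subrr.
(* [S * G = 1] modulo ['X^N] gives the column 0 recurrence of [tri]; the equation for [F], times
   [G * F ^+ k], gives that of column [k.+1]. *)
have GE : G = 1 + 'X * (a%:P * G + 2 * b%:P * (G * F)) + (r1 * G + r2) * 'X^N.
  transitivity (1 + 'X * (a%:P * G + 2 * b%:P * (G * F)) + (S - T) * G + (T * G - 1)).
    by rewrite /S; ring.
  by rewrite E1 E2; ring.
have GFE k : G * F ^+ k.+1 = 'X * (a%:P * (G * F ^+ k.+1) + G * F ^+ k
    + b%:P * (G * F ^+ k.+2)) + G * F ^+ k * r * 'X^N.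
  transitivity (G * F ^+ k * ('X * (1 + a%:P * F + b%:P * F ^+ 2) + r * 'X^N)).
    by rewrite -FE exprSr mulrA.
  by rewrite !exprS; ring.
suff triE m k : (m < N)%N -> (G * F ^+ k)`_m = tri a b m k.
  by rewrite -triE // expr0 mulr1 coef_poly ltnSn.
elim: m k => [|m IH] [|k] ltmN.
- by rewrite expr0 mulr1 GE !coefD coefMXn ltmN coefXM coef1 !addr0.
- by rewrite GFE coefD coefMXn ltmN coefXM addr0.
- rewrite expr0 mulr1 GE !coefD coefMXn ltmN coefXM coef1 add0r addr0 /=.
  rewrite coefD coefCM -(rmorph_nat polyC) -polyCM coefCM.
  have := IH 0%N (ltnW ltmN); have := IH 1%N (ltnW ltmN).
  by rewrite expr0 expr1 mulr1 => -> ->.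
- rewrite GFE coefD coefMXn ltmN coefXM addr0 /= !coefD !coefCM.
  by rewrite !IH // ltnW.
Qed.

End GeneratingFunction.

Theorem mainTheorem2 (R : comUnitRingType) (unit2 : (2 : R) \is a GRing.unit)
    (a b : R) (g : nat -> R) (gP : is_gseq a b g) (n : nat) (n_gt0 : (0 < n)%N) :
  [/\ \det (\matrix_(i < n, j < n) g (i + j)%N) = 2 ^+ n.-1 * b ^+ 'C(n, 2),
      \det (\matrix_(i < n, j < n) g (i + j + 1)%N)
        = 2 ^+ n.-1 * b ^+ 'C(n, 2) * Luc a (- b) n
    & \det (\matrix_(i < n, j < n) g (i + j + 2)%N)
        = 2 ^+ n.-1 * b ^+ 'C(n, 2)
          * (2 * b ^+ n + \sum_(1 <= j < n.+1) Luc a (- b) j ^+ 2 * b ^+ (n - j))].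
Proof.
have gE m : g m = tri a b m 0 by exact: gseq_tri.
have natmxE (u : nat -> nat -> nat) :
    \matrix_(i < n, j < n) g (u i j) = natmx n n (fun i j => tri a b (u i j) 0).
  by apply/matrixP => i j; rewrite !mxE gE.
rewrite (natmxE (fun i j => i + j)%N) (natmxE (fun i j => i + j + 1)%N).
rewrite (natmxE (fun i j => i + j + 2)%N).
rewrite det_tri_hankel det_tri_hankel1 det_tri_hankel2.
case: n n_gt0 {natmxE} => // n _; rewrite prod_wt; split=> //.
exact: det_jacsq_closed.
Qed.
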